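(* Let $\Omega_1\subseteq\mathbb R^d$ and $\Omega_2\subseteq\mathbb R^n$ be closed convex sets, and let $f:\Omega_1\times\Omega_2\to\mathbb R$ be continuous, $\mu$-strongly convex in $x\in\Omega_1$ for every $y\in\Omega_2$ and $\lambda$-strongly concave in $y\in\Omega_2$ for every $x\in\Omega_1$ ($\mu,\lambda>0$). Let $(x^*,y^* )$ denote the saddle point of $\min_{x\in\Omega_1}\max_{y\in\Omega_2}f(x,y)$. Then for any two points $(x_0,y_0),(x_1,y_1)\in\Omega_1\times\Omega_2$, $$\frac\mu4\|\hat x(y_1)-x_0\|^2+\frac\lambda4\|\hat y(x_1)-y_0\|^2\ \le\ \max_{y'\in\Omega_2}f(x_0,y')-\min_{x'\in\Omega_1}f(x',y_0)+\max_{y'\in\Omega_2}f(x_1,y')-\min_{x'\in\Omega_1}f(x',y_1).$$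
   Context: $\|\cdot\|$ is the Euclidean norm; $\hat x(y)=\arg\min_{x'\in\Omega_1}f(x',y)$ and $\hat y(x)=\arg\max_{y'\in\Omega_2}f(x,y')$. A saddle point $(x^*,y^* )\in\Omega_1\times\Omega_2$ satisfies $f(x^*,y)\le f(x^*,y^* )\le f(x,y^* )$ for all $x\in\Omega_1,y\in\Omega_2$. A function $h$ is $\mu$-strongly convex on $\Omega$ if $v^\top(x-x')+\frac\mu2\|x-x'\|^2\le h(x)-h(x')$ for all $x,x'\in\Omega$ and $v\in\partial h(x')$; $h$ is $\lambda$-strongly concave if $-h$ is $\lambda$-strongly convex. *)

(* Defs.v *)
From mathcomp Require Import all_boot all_order all_algebra.
From mathcomp Require Import all_classical all_reals all_analysis.

Set Implicit Arguments.
Unset Strict Implicit.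
Unset Printing Implicit Defensive.

Import Order.TTheory GRing.Theory Num.Theory.
Import numFieldNormedType.Exports.

Local Open Scope classical_set_scope.
Local Open Scope ring_scope.

(* The library norm `|v| on matrices is the sup norm, hence this definition.
   The topology on 'cV[R]_d is the same for both norms. *)
Definition norm2 (R : realType) (d : nat) (v : 'cV[R]_d) : R :=
  Num.sqrt (\sum_(i < d) v i ord0 ^+ 2).

Definition dotv (R : realType) (d : nat) (u v : 'cV[R]_d) : R :=
  (u^T *m v) ord0 ord0.

(* In the definitions below, a function on a subset A of R^d is represented by
   a total function h of which only the values on A are used. *)

Definition subdifferential (R : realType) (d : nat)
    (A : set 'cV[R]_d) (h : 'cV[R]_d -> R) (x' : 'cV[R]_d) : set 'cV[R]_d :=
  [set v | forall x, A x -> h x' + dotv v (x - x') <= h x].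

(* Convexity is required explicitly: the subgradient inequality alone would
   hold vacuously for a nonconvex function all of whose subdifferentials are
   empty. *)
Definition strongly_convex (R : realType) (d : nat) (mu : R)
    (A : set 'cV[R]_d) (h : 'cV[R]_d -> R) : Prop :=
  @convex_function R 'cV[R]_d A h /\
  forall x x' v, A x -> A x' -> subdifferential A h x' v ->
    dotv v (x - x') + mu / 2 * norm2 (x - x') ^+ 2 <= h x - h x'.

Definition strongly_concave (R : realType) (d : nat) (lambda : R)
    (A : set 'cV[R]_d) (h : 'cV[R]_d -> R) : Prop :=
  strongly_convex lambda A (fun x => - h x).

Definition minimizers (R : realType) (d : nat)
    (A : set 'cV[R]_d) (h : 'cV[R]_d -> R) : set 'cV[R]_d :=
  [set x | A x /\ forall x', A x' -> h x <= h x'].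

Definition maximizers (R : realType) (d : nat)
    (A : set 'cV[R]_d) (h : 'cV[R]_d -> R) : set 'cV[R]_d :=
  [set x | A x /\ forall x', A x' -> h x' <= h x].

(* [get S] is an element of S whenever S is nonempty.  If h is continuous and
   strongly convex (resp. concave) on a nonempty closed convex set A, then
   [minimizers A h] (resp. [maximizers A h]) is a singleton. *)
Definition argmin (R : realType) (d : nat)
    (A : set 'cV[R]_d) (h : 'cV[R]_d -> R) : 'cV[R]_d := get (minimizers A h).

Definition argmax (R : realType) (d : nat)
    (A : set 'cV[R]_d) (h : 'cV[R]_d -> R) : 'cV[R]_d := get (maximizers A h).

Definition minval (R : realType) (d : nat)
    (A : set 'cV[R]_d) (h : 'cV[R]_d -> R) : R := h (argmin A h).

Definition maxval (R : realType) (d : nat)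
    (A : set 'cV[R]_d) (h : 'cV[R]_d -> R) : R := h (argmax A h).

Definition saddle_point (R : realType) (d n : nat)
    (A : set 'cV[R]_d) (B : set 'cV[R]_n) (f : 'cV[R]_d -> 'cV[R]_n -> R)
    (xs : 'cV[R]_d) (ys : 'cV[R]_n) : Prop :=
  [/\ A xs, B ys &
      forall x y, A x -> B y -> f xs y <= f xs ys /\ f xs ys <= f x ys].

(* Main.v *)
(** Bounding the two maxima from below at [y1] and at the maximizer of [f x1],
    and the two minima from above at [x1] and at the minimizer of [f ^~ y1],
    leaves the sum of [f x0 y1 - min f(., y1)] and [max f(x1, .) - f x1 y0].
    Since [0] is a subgradient at a minimizer, strong convexity bounds these
    from below by [mu / 2] and [lambda / 2] times the squared distances.

    The minima are attained: a continuous convex function on a closed convex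
    set has a subgradient at some point, where the strong convexity inequality
    gives quadratic growth, so that sublevel sets are compact. *)

Require Import Defs.
From mathcomp Require Import all_boot all_order all_algebra.
From mathcomp Require Import all_classical all_reals all_analysis.
From mathcomp Require Import ring lra.
Import Order.TTheory GRing.Theory Num.Theory.
Import numFieldNormedType.Exports.
Local Open Scope classical_set_scope.
Local Open Scope ring_scope.

(** * The dot product and its comparison with the sup norm *)

Lemma dotvE (R : realType) (d : nat) (u v : 'cV[R]_d) :
  dotv u v = \sum_(i < d) u i ord0 * v i ord0.
Proof. by rewrite /dotv mxE; apply: eq_bigr => i _; rewrite mxE. Qed.

Lemma dotvC (R : realType) (d : nat) (u v : 'cV[R]_d) : dotv u v = dotv v u.
Proof. by rewrite !dotvE; apply: eq_bigr => i _; rewrite mulrC. Qed.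

Lemma dotvDr (R : realType) (d : nat) (u v w : 'cV[R]_d) :
  dotv u (v + w) = dotv u v + dotv u w.
Proof. by rewrite /dotv mulmxDr mxE. Qed.

Lemma dotvDl (R : realType) (d : nat) (u v w : 'cV[R]_d) :
  dotv (u + v) w = dotv u w + dotv v w.
Proof. by rewrite ![dotv _ w]dotvC dotvDr. Qed.

Lemma dotvZr (R : realType) (d : nat) (k : R) (u v : 'cV[R]_d) :
  dotv u (k *: v) = k * dotv u v.
Proof. by rewrite /dotv -scalemxAr mxE. Qed.

Lemma dotvZl (R : realType) (d : nat) (k : R) (u v : 'cV[R]_d) :
  dotv (k *: u) v = k * dotv u v.
Proof. by rewrite ![dotv _ v]dotvC dotvZr. Qed.

Lemma dotvvDZ (R : realType) (d : nat) (k : R) (u w : 'cV[R]_d) :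
  dotv (u + k *: w) (u + k *: w) =
  dotv u u + 2 * k * dotv u w + k ^+ 2 * dotv w w.
Proof. by rewrite dotvDl !dotvDr !dotvZl !dotvZr (dotvC _ _ w); ring. Qed.

Lemma dotvv_ge0 (R : realType) (d : nat) (v : 'cV[R]_d) : 0 <= dotv v v.
Proof. by rewrite dotvE sumr_ge0 // => i _; rewrite -expr2 sqr_ge0. Qed.

Lemma norm2_sqr (R : realType) (d : nat) (v : 'cV[R]_d) :
  norm2 v ^+ 2 = dotv v v.
Proof.
rewrite /norm2 sqr_sqrtr; last by rewrite sumr_ge0 // => i _; rewrite sqr_ge0.
by rewrite dotvE; apply: eq_bigr => i _; rewrite expr2.
Qed.

(** The sup norm is attained at one coordinate, whose square is one term of the sum. *)
Lemma mx_norm_sqr_le (R : realType) (d : nat) (v : 'cV[R]_d) :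
  `|v| ^+ 2 <= dotv v v.
Proof.
have [->|v_neq0] := eqVneq (`|v|) 0; first by rewrite expr0n dotvv_ge0.
have [[i j] /= vij] := mx_norm_neq0 v_neq0.
have -> : `|v| = `|v i j| by exact: vij.
rewrite real_normK ?num_real // ord1 dotvE (bigD1 i) //= -expr2 lerDl.
by rewrite sumr_ge0 // => k _; rewrite -expr2 sqr_ge0.
Qed.

Lemma dotvv_continuous (R : realType) (d : nat) (a : 'cV[R]_d) :
  continuous (fun x : 'cV[R]_d => dotv (x - a) (x - a)).
Proof.
under eq_fun do rewrite dotvE.
apply: continuous_big => [|i _ x]; first exact: add_continuous.
have coord : (fun x : 'cV[R]_d => (x - a) i ord0) @ x --> (x - a) i ord0.
  under eq_fun do rewrite !mxE.
  rewrite !mxE.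
  exact: (cvgB (F := nbhs x) (@coord_continuous _ _ _ i ord0 x) (cvg_cst _)).
exact: (cvgM (F := nbhs x) coord coord).
Qed.

(** * Minimization over boxes and existence of a subgradient *)

Lemma trmx_continuous (R : realType) (m n : nat) :
  continuous (@trmx R m n).
Proof.
move=> A S /nbhs_ballP[e /= e_gt0 eS]; apply/nbhs_ballP; exists e => //= B.
by move=> [_ AB]; apply: eS; split=> // i j; rewrite !mxE; exact: AB.
Qed.

(** Heine-Borel for row vectors is carried over by transposition, which is continuous and does not
    change the sup norm. *)
Lemma bounded_closed_compact_cV (R : realType) (d : nat) (A : set 'cV[R]_d) :
  bounded_set A -> closed A -> compact A.
Proof.
move=> Abnd Acl.
have -> : A = trmx @` (trmx @^-1` A).
  apply/seteqP; split=> [x Ax|_ [y Ay <-] //].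
  by exists x^T; rewrite /= trmxK.
apply: continuous_compact.
  by apply: continuous_subspaceT => x; exact: trmx_continuous.
apply: bounded_closed_compact; last first.
  by apply: closed_comp => // x _; exact: trmx_continuous.
have normT (x : 'rV[R]_d) : `|x| <= `|x^T|.
  have [->|x_neq0] := eqVneq (`|x|) 0; first exact: normr_ge0.
  have [[i j] /= xij] := mx_norm_neq0 x_neq0.
  have -> : `|x| = `|x^T j i| by rewrite mxE; exact: xij.
  rewrite [leRHS]/Num.norm /= mx_normrE.
  by apply/bigmax_geP; right; exists (j, i).
have [M [Mreal AM]] := Abnd.
exists M; split=> // r Mr x Ax.
exact: le_trans (normT x) (AM r Mr _ Ax).
Qed.

Lemma exists_min_on_box (R : realType) (d : nat) (A : set 'cV[R]_d)
    (g : 'cV[R]_d -> R) (a : 'cV[R]_d) (r : R) :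
  closed A -> {within A, continuous g} -> A a -> 0 <= r ->
  exists p, [/\ A p, `|p - a| <= r &
    forall x, A x -> `|x - a| <= r -> g p <= g x].
Proof.
move=> Acl gcont Aa r_ge0.
pose B := A `&` [set x | `|x - a| <= r].
have Bcompact : compact B.
  apply: bounded_closed_compact_cV.
    exists (`|a| + r); split; first exact: num_real.
    move=> s /ltW rs x [_ xa]; apply: le_trans rs.
    rewrite -[x](subrK a) addrC.
    by apply: le_trans (ler_normD _ _) _; rewrite lerD2l.
  apply: closedI => //.
  apply: (@closed_comp _ _ (fun x : 'cV[R]_d => `|x - a|) [set s : R | s <= r]).
    move=> x _; have idc : id @ nbhs x --> x by exact: cvg_id.
    exact: (cvg_norm (cvgB (F := nbhs x) idc (cvg_cst a))).
  exact: closed_le.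
have [||p] := @compact_EVT_min _ R g B _ Bcompact.
- by exists a; split=> //=; rewrite subrr normr0.
- by apply: continuous_subspaceW gcont => x [].
rewrite inE => -[Ap pa] pmin; exists p; split=> // x Ax xa.
by apply: pmin; rewrite inE.
Qed.

(* The proximal point of [a] has a subgradient. Confining the minimization of
   [h + M |. - a|^2] to a box makes a minimizer exist; a large [M] pushes it
   off the boundary of the box, so that it is optimal in all directions. *)
Lemma exists_subgradient (R : realType) (d : nat) (A : set 'cV[R]_d)
    (h : 'cV[R]_d -> R) (a : 'cV[R]_d) :
  closed A -> @convex_set R 'cV[R]_d A -> @convex_function R 'cV[R]_d A h ->
  {within A, continuous h} -> A a ->
  exists p v, A p /\ subdifferential A h p v.
Proof.
move=> Acl Aconv hconv hcont Aa.
have [q [Aq qa qmin]] := @exists_min_on_box _ _ _ _ _ 1 Acl hcont Aa ler01.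
(* [h a - h q] is the largest drop of [h] from [a] within the unit box, and [M] exceeds it. *)
pose M := h a - h q + 1.
have hqa : h q <= h a by apply: qmin; rewrite // subrr normr0.
have M_gt0 : 0 < M by rewrite /M; lra.
pose g x := h x + M * dotv (x - a) (x - a).
have gcont : {within A, continuous g}.
  apply/subspace_continuousP => x Ax.
  have hx := (subspace_continuousP A h).1 hcont x Ax.
  have dx : dotv (y - a) (y - a) @[y --> within A (nbhs x)] -->
      dotv (x - a) (x - a).
    by apply: cvg_within_filter; exact: dotvv_continuous.
  exact: (cvgD (F := within A (nbhs x)) hx (cvgM (cvg_cst M) dx)).
have [p [Ap pa pmin]] := @exists_min_on_box _ _ _ _ _ 1 Acl gcont Aa ler01.
(* From [g p <= g a = h a] and [h q <= h p], the penalty at [p] is at most [h a - h q < M], so the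
   squared distance is below 1. *)
have pa_lt1 : `|p - a| < 1.
  have := pmin a Aa; rewrite subrr normr0 ler01 => /(_ isT).
  have dotv00 : dotv (a - a) (a - a) = 0 by rewrite subrr /dotv mulmx0 mxE.
  rewrite /g dotv00 mulr0 addr0 => pmina.
  have hqp := qmin p Ap pa.
  have sq_lt1 : dotv (p - a) (p - a) < 1.
    by rewrite -(ltr_pM2l M_gt0) mulr1 /M in pmina *; lra.
  rewrite -[_ < 1](ltr_pXn2r (n := 2)) ?nnegrE ?expr1n //.
  exact: le_lt_trans (mx_norm_sqr_le _ _ _) sq_lt1.
(* The candidate is minus the gradient of the penalty [M |. - a|^2] at [p], as the first-order
   optimality condition suggests. *)
exists p, ((2 * M) *: (a - p)); split=> // x Ax.
rewrite leNgt; apply/negP => x_lt.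
pose w := x - p.
pose c := h p + dotv ((2 * M) *: (a - p)) w - h x.
have c_gt0 : 0 < c by rewrite /c; rewrite -subr_gt0 in x_lt.
(* [c] is the assumed violation of the subgradient inequality at [x]. Moving from [p] by the
   fraction [1 / K] towards [x] stays in the box; there convexity gains [c / K] to first order,
   while the penalty costs only [M |w|^2 / K^2] to second order. *)
have step K : 1 <= K -> `|w| <= (1 - `|p - a|) * K -> c * K <= M * dotv w w.
  move=> K_ge1 wK.
  have K_gt0 : 0 < K by lra.
  have t_ge0 : 0 <= K^-1 by rewrite invr_ge0 ltW.
  have t_le1 : K^-1 <= 1 by rewrite invf_le1.
  pose t := @Itv01 R K^-1 t_ge0 t_le1.
  have zE : (conv t (x : convex_lmodType 'cV[R]_d) p : 'cV[R]_d) = p + K^-1 *: w.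
    rewrite /conv /= /unstable.onem scalerBl scale1r /w scalerBr.
    by rewrite addrCA addrA.
  have Az : A (p + K^-1 *: w).
    by have := Aconv x p t; rewrite !inE => /(_ Ax Ap); rewrite zE.
  have hz : h (p + K^-1 *: w) <= K^-1 * h x + (1 - K^-1) * h p.
    by have := hconv t x p; rewrite !inE => /(_ Ax Ap); rewrite zE.
  have za : `|p + K^-1 *: w - a| <= 1.
    rewrite addrAC; apply: le_trans (ler_normD _ _) _.
    rewrite normrZ ger0_norm // -lerBrDl mulrC ler_pdivrMr //.
  have := pmin _ Az za.
  rewrite /g -addrA [_ *: w - a]addrC addrA dotvvDZ => pz.
  have apw : dotv (a - p) w = - dotv (p - a) w.
    by rewrite -opprB -scaleN1r dotvZl mulN1r.
  have cE : c = h p - h x - 2 * M * dotv (p - a) w.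
    by rewrite /c dotvZl apw; ring.
  have : 0 <= K ^+ 2 * (K^-1 * (h x - h p)
     + M * (2 * K^-1 * dotv (p - a) w + K^-1 ^+ 2 * dotv w w)).
    by rewrite mulr_ge0 ?sqr_ge0 //; lra.
  suff -> : K ^+ 2 * (K^-1 * (h x - h p)
     + M * (2 * K^-1 * dotv (p - a) w + K^-1 ^+ 2 * dotv w w)) =
     M * dotv w w - c * K by lra.
  by rewrite cE; field; rewrite gt_eqF.
have w_ge0 := normr_ge0 w; have D_ge0 := dotvv_ge0 _ _ w.
have del_gt0 : 0 < 1 - `|p - a| by lra.
have t1 : 0 <= `|w| / (1 - `|p - a|) by rewrite divr_ge0 // ltW.
have MD_ge0 : 0 <= M * dotv w w by rewrite mulr_ge0 // ltW.
have t2 : 0 <= M * dotv w w / c by rewrite divr_ge0 // ltW.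
(* The first term makes [1 / K] a convex weight, the second keeps the step in the box, and the
   third, with the 1, forces [c * K > M |w|^2]. *)
pose K := 1 + `|w| / (1 - `|p - a|) + M * dotv w w / c.
have K_ge1 : 1 <= K by rewrite /K; lra.
have wK : `|w| <= (1 - `|p - a|) * K.
  by rewrite mulrC -ler_pdivrMr // /K; lra.
have := step K K_ge1 wK; rewrite mulrC -ler_pdivlMr // /K; lra.
Qed.

(** * Quadratic growth and attainment of minima *)

(** Completing the square: the two sides differ by [|v + (mu / 2) w|^2 / mu]. Half of the quadratic
    term absorbs the linear one. *)
Lemma dotv_quadratic_ge (R : realType) (d : nat) (mu : R) (v w : 'cV[R]_d) :
  0 < mu ->
  mu / 4 * dotv w w - dotv v v / mu <= dotv v w + mu / 2 * dotv w w.
Proof.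
move=> mu_gt0; have := dotvv_ge0 _ _ (v + (mu / 2) *: w).
rewrite dotvvDZ => sq_ge0.
rewrite -subr_ge0.
have -> : dotv v w + mu / 2 * dotv w w - (mu / 4 * dotv w w - dotv v v / mu) =
    mu^-1 * (dotv v v + 2 * (mu / 2) * dotv v w + (mu / 2) ^+ 2 * dotv w w).
  by field; rewrite gt_eqF.
by rewrite mulr_ge0 // invr_ge0 ltW.
Qed.

Lemma minimizers_nonempty (R : realType) (d : nat) (mu : R)
    (A : set 'cV[R]_d) (h : 'cV[R]_d -> R) :
  0 < mu -> closed A -> @convex_set R 'cV[R]_d A -> A !=set0 ->
  {within A, continuous h} -> strongly_convex mu A h ->
  minimizers A h !=set0.
Proof.
move=> mu_gt0 Acl Aconv [a Aa] hcont [hconv hstrong].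
have [p [v [Ap vsub]]] := exists_subgradient _ _ _ _ _ Acl Aconv hconv hcont Aa.
(* Beyond distance [r] from [p], growth gives [h p <= h x]: this needs
   [|x - p|^2 >= 4 |v|^2 / mu^2], and adding 1 gives [r ^+ 2 >= r], which avoids a square root. *)
pose r := dotv v v / mu * (4 / mu) + 1.
have vmu_ge0 : 0 <= dotv v v / mu by rewrite divr_ge0 ?dotvv_ge0 ?ltW.
have r_ge1 : 1 <= r by rewrite /r lerDr mulr_ge0 // divr_ge0 // ltW.
have r_ge0 : 0 <= r by lra.
have [q [Aq _ qmin]] := exists_min_on_box _ _ _ _ _ _ Acl hcont Ap r_ge0.
have qp : h q <= h p by apply: qmin; rewrite // subrr normr0.
exists q; split=> // x Ax.
have [xp|xp] := leP `|x - p| r; first exact: qmin.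
apply: le_trans qp _.
have := hstrong x p v Ax Ap vsub; rewrite norm2_sqr.
have := dotv_quadratic_ge _ _ _ v (x - p) mu_gt0.
suff : dotv v v / mu <= mu / 4 * dotv (x - p) (x - p) by lra.
have mu4_gt0 : 0 < mu / 4 by rewrite divr_gt0.
rewrite -ler_pdivrMl // invf_div mulrC.
apply: le_trans (mx_norm_sqr_le _ _ _).
by rewrite /r in xp r_ge1 *; nra.
Qed.

Lemma minimizer_quadratic_growth (R : realType) (d : nat) (mu : R)
    (A : set 'cV[R]_d) (h : 'cV[R]_d -> R) (p x : 'cV[R]_d) :
  strongly_convex mu A h -> minimizers A h p -> A x ->
  mu / 2 * norm2 (p - x) ^+ 2 <= h x - h p.
Proof.
move=> [_ hstrong] [Ap pmin] Ax.
have zero_sub : subdifferential A h p 0.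
  by move=> y Ay; rewrite /dotv trmx0 mul0mx mxE addr0; exact: pmin.
have := hstrong x p 0 Ax Ap zero_sub.
by rewrite {1}/dotv trmx0 mul0mx mxE add0r !norm2_sqr -opprB -scaleN1r
  dotvZl dotvZr !mulN1r opprK.
Qed.

(** * The chosen optima and the final inequality *)

Lemma argminP (R : realType) (d : nat) (mu : R)
    (A : set 'cV[R]_d) (h : 'cV[R]_d -> R) :
  0 < mu -> closed A -> @convex_set R 'cV[R]_d A -> A !=set0 ->
  {within A, continuous h} -> strongly_convex mu A h ->
  minimizers A h (argmin A h).
Proof.
move=> mu_gt0 Acl Aconv A0 hcont hstrong.
apply: getPex.
exact: (minimizers_nonempty _ _ _ _ _ mu_gt0 Acl Aconv A0 hcont hstrong).
Qed.

(** The two sets of optima are equal, so [get] picks the same point in both; uniqueness does not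
    enter. *)
Lemma argmaxN (R : realType) (d : nat)
    (A : set 'cV[R]_d) (h : 'cV[R]_d -> R) :
  argmax A h = argmin A (fun x => - h x).
Proof.
rewrite /argmax /argmin; congr get; apply/seteqP.
by split=> x [Ax xopt]; split=> // y Ay; have := xopt y Ay; rewrite lerN2.
Qed.

(** Serves to pass from joint continuity of [f] to its slices, with [g] pairing a variable with a
    fixed point. *)
Lemma within_continuous_precomp (S T U : topologicalType) (A : set S)
    (B : set T) (g : S -> T) (f : T -> U) :
  continuous g -> (forall x, A x -> B (g x)) ->
  {within B, continuous f} -> {within A, continuous (f \o g)}.
Proof.
move=> gcont gAB fcont; apply/subspace_continuousP => x Ax.
apply: cvg_trans ((subspace_continuousP _ _).1 fcont (g x) (gAB x Ax)) => V.
move=> /= /(gcont x); rewrite !nbhs_simpl /within /=.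
by apply: filterS => z gzV Az; apply: gzV; exact: gAB.
Qed.

Theorem lemma1 (R : realType) (d n : nat)
    (Omega1 : set 'cV[R]_d) (Omega2 : set 'cV[R]_n)
    (f : 'cV[R]_d -> 'cV[R]_n -> R) (mu lambda : R)
    (closed1 : closed Omega1) (closed2 : closed Omega2)
    (convex1 : @convex_set R 'cV[R]_d Omega1)
    (convex2 : @convex_set R 'cV[R]_n Omega2)
    (f_cont : {within Omega1 `*` Omega2,
                 continuous (fun z : 'cV[R]_d * 'cV[R]_n => f z.1 z.2)})
    (mu_gt0 : 0 < mu) (lambda_gt0 : 0 < lambda)
    (f_convex : forall y, Omega2 y ->
       strongly_convex mu Omega1 (fun x => f x y))
    (f_concave : forall x, Omega1 x ->
       strongly_concave lambda Omega2 (fun y => f x y))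
    (xs : 'cV[R]_d) (ys : 'cV[R]_n)
    (saddle : saddle_point Omega1 Omega2 f xs ys)
    (x0 x1 : 'cV[R]_d) (y0 y1 : 'cV[R]_n)
    (x0_in : Omega1 x0) (y0_in : Omega2 y0)
    (x1_in : Omega1 x1) (y1_in : Omega2 y1) :
  mu / 4 * norm2 (argmin Omega1 (fun x' => f x' y1) - x0) ^+ 2
    + lambda / 4 * norm2 (argmax Omega2 (fun y' => f x1 y') - y0) ^+ 2
  <= (maxval Omega2 (fun y' => f x0 y') - minval Omega1 (fun x' => f x' y0))
     + (maxval Omega2 (fun y' => f x1 y') - minval Omega1 (fun x' => f x' y1)).
Proof.
have xmin y : Omega2 y ->
    minimizers Omega1 (fun x => f x y) (argmin Omega1 (fun x => f x y)).
  move=> y_in; apply: (argminP _ _ _ _ _ mu_gt0 closed1 convex1) => //.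
  - by exists x0.
  - apply: (within_continuous_precomp _ _ _ _ _ (fun x => (x, y)) _ _ _ f_cont).
      by move=> x; apply: (cvg_pair (F := nbhs x)) cvg_id (cvg_cst y).
    by [].
  - exact: f_convex.
have ymax x : Omega1 x ->
    minimizers Omega2 (fun y => - f x y) (argmax Omega2 (fun y => f x y)).
  move=> x_in; rewrite argmaxN.
  apply: (argminP _ _ _ _ _ lambda_gt0 closed2 convex2) => //.
  - by exists y0.
  - apply/subspace_continuousP => y y_in; apply: cvgN.
    have sliceP : {within Omega2, continuous
        ((fun z : 'cV[R]_d * 'cV[R]_n => f z.1 z.2) \o pair x)}.
      apply: (within_continuous_precomp _ _ _ _ _ _ _ _ _ f_cont) => // z.
      exact: (cvg_pair (F := nbhs z)) (cvg_cst x) cvg_id.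
    exact: (subspace_continuousP _ _).1 sliceP y y_in.
  - exact: f_concave.
have x_growth := minimizer_quadratic_growth _ _ _ _ _ _ _
  (f_convex y1 y1_in) (xmin y1 y1_in) x0_in.
have y_growth := minimizer_quadratic_growth _ _ _ _ _ _ _
  (f_concave x1 x1_in) (ymax x1 x1_in) y0_in.
(* Testing the first maximum at [y1] and the first minimum at [x1] leaves exactly the two gaps
   bounded by [x_growth] and [y_growth]. *)
have := (ymax x0 x0_in).2 y1 y1_in; rewrite lerN2 => max_ge.
have min_le := (xmin y0 y0_in).2 x1 x1_in.
(* Nonnegativity weakens the factors [mu / 2] and [lambda / 2] to [mu / 4] and [lambda / 4]. *)
have x_ge0 : 0 <= mu * norm2 (argmin Omega1 (fun x' => f x' y1) - x0) ^+ 2.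
  by rewrite mulr_ge0 ?sqr_ge0 // ltW.
have y_ge0 : 0 <= lambda * norm2 (argmax Omega2 (fun y' => f x1 y') - y0) ^+ 2.
  by rewrite mulr_ge0 ?sqr_ge0 // ltW.
rewrite /maxval /minval; lra.
Qed.
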